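(* Let $V$ be a vector configuration with no element equal to the zero vector and with $\mathrm{DD}(V)>0$. Put $r:=\operatorname{rank}(V)$, $\delta:=\deg^*(V)$ and $d:=|V|-r-1$. Then $V$ admits a codegree$^*$ decomposition of length at least \[ r+1-2\,\mathrm{DD}(V)\;=\;2(d+1-2\delta)-r+1\;=\;3d+4-4\delta-|V|. \]
   Context: A vector configuration is a finite family (repetitions allowed) $V$ of vectors in $\mathbb{R}^r$; a subconfiguration is a subfamily, $\operatorname{rank}(V)=\dim\operatorname{lin}(V)$, and all cardinalities count multiplicities. For a nonzero linear functional $f$ on $\mathbb{R}^r$, the oriented linear hyperplane $H=\{f=0\}$ has sides $H^+=\{f>0\}$, $H^-=\{f<0\}$, $\overline{H}^-=\{f\le 0\}$. The dual codegree of a (sub)configuration $W$ is $\operatorname{codeg}^*(W)=\min_H|\overline{H}^-\cap W|$ and its dual degree is $\deg^*(W)=\max_H|H^+\cap W|-\operatorname{rank}(W)$, both over oriented linear hyperplanes $H$. The covector discrepancy is $\mathrm{DD}(W)=\max_f\big|\,|\{w\in W: f(w)>0\}|-|\{w\in W:f(w)<0\}|\,\big|$ over all linear functionals $f$. A codegree$^*$ decomposition of $V$ of length $m$ is a partition $V=V_0\uplus V_1\uplus\dots\uplus V_m$ into subconfigurations ($V_0$ possibly empty) such that $\operatorname{codeg}^*(V)=\sum_{i=1}^m\operatorname{codeg}^*(V_i)$ and $\operatorname{codeg}^*(V_i)\ge1$ for $1\le i\le m$. *)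

(* Defs.v *)
From HB Require Import structures.
From mathcomp Require Import all_boot all_order all_algebra.
From mathcomp Require Import boolp reals.
Set Implicit Arguments. Unset Strict Implicit. Unset Printing Implicit Defensive.
Import Order.TTheory GRing.Theory Num.Theory.
Local Open Scope ring_scope.

(* A vector configuration of n vectors (repetitions allowed) in R^dim is a
   family V : 'I_n -> 'rV[R]_dim ; a subconfiguration is a subfamily,
   given by a set of indices S : {set 'I_n}.  A linear functional on R^dim
   is represented by a column vector c : 'cV_dim, acting by v |-> (v *m c) 0 0;
   an oriented linear hyperplane is {f = 0} for a nonzero functional f. *)
Section Config.
Variables (R : realType) (dim n : nat) (V : 'I_n -> 'rV[R]_dim).

Definition fval (c : 'cV[R]_dim) (v : 'rV[R]_dim) : R := (v *m c) 0 0.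

Definition crank (S : {set 'I_n}) : nat :=
  \rank (\matrix_(i < n) (if i \in S then V i else 0)).

Definition npos (c : 'cV[R]_dim) (S : {set 'I_n}) : nat :=
  #|[set i in S | 0 < fval c (V i)]|.
Definition nneg (c : 'cV[R]_dim) (S : {set 'I_n}) : nat :=
  #|[set i in S | fval c (V i) < 0]|.
Definition nnonpos (c : 'cV[R]_dim) (S : {set 'I_n}) : nat :=
  #|[set i in S | fval c (V i) <= 0]|.

Definition codeg (S : {set 'I_n}) : nat :=
  \big[minn/n]_(k < n.+1 |
     `[< exists c : 'cV[R]_dim, c != 0 /\ nnonpos c S = k >]) (k : nat).

Definition degs (S : {set 'I_n}) : int :=
  (\big[maxn/0]_(k < n.+1 |
     `[< exists c : 'cV[R]_dim, c != 0 /\ npos c S = k >]) (k : nat))%:Z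
  - (crank S)%:Z.

Definition DD (S : {set 'I_n}) : nat :=
  \big[maxn/0]_(k < n.+1 |
     `[< exists c : 'cV[R]_dim, `|(npos c S)%:Z - (nneg c S)%:Z|%N = k >]) (k : nat).

Definition block (m : nat) (p : 'I_n -> 'I_m.+1) (j : 'I_m.+1) : {set 'I_n} :=
  [set i | p i == j].

Definition codeg_decomposition (m : nat) (p : 'I_n -> 'I_m.+1) : Prop :=
  codeg [set: 'I_n] = \sum_(j < m.+1 | j != ord0) codeg (block p j)
  /\ (forall j : 'I_m.+1, j != ord0 -> (1 <= codeg (block p j))%N).

End Config.

(* Main.v *)
Require Import Defs.
From HB Require Import structures.
From mathcomp Require Import all_boot all_order all_algebra.
From mathcomp Require Import boolp reals.
From mathcomp Require Import zify ring lra.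
Import Order.TTheory GRing.Theory Num.Theory.
Set Implicit Arguments. Unset Strict Implicit. Unset Printing Implicit Defensive.
Local Open Scope ring_scope.

(* For a functional f let B(f) be the number of vectors on which f is positive
   minus the number on which it is negative, so that DD = max |B|.  Discarding a
   maximal family of k antipodal pairs changes no B(f), and lowers both the dual
   codegree by k and the rank by at most k.  If T is what remains, then the
   pairs, together with T when codeg T > 0, form the required decomposition as
   soon as rank T <= 2 DD.

   For this bound it suffices to find f with B(f) <> 0 vanishing on a flat of
   corank at most 2 in a configuration of rank s without antipodal pairs: by
   induction some g has B(g) >= (s - 2) / 2 on that flat, and f + eps g gains at
   least 1.  Take f with B(f) <> 0 whose flat is as large as possible, contract
   the flat, and suppose that the rank of the contraction is at least 3.  Then B
   vanishes on every wall, so two points of the projective picture with no third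
   point between them have opposite weights.  Choose a triangle of minimal
   nonzero area with a vertex of nonzero weight: no side contains a further
   point, so its three weights are pairwise opposite, which is absurd. *)

(** * Functionals, small perturbations and balance *)

Section Functionals.
Variables (R : realType) (d : nat).
Implicit Types (c f g : 'cV[R]_d) (v w : 'rV[R]_d).

Lemma fvalDl c f v : fval (c + f) v = fval c v + fval f v.
Proof. by rewrite /fval mulmxDr mxE. Qed.

Lemma fvalZl a c v : fval (a *: c) v = a * fval c v.
Proof. by rewrite /fval -scalemxAr mxE. Qed.

Lemma fvalNl c v : fval (- c) v = - fval c v.
Proof. by rewrite -scaleN1r fvalZl mulN1r. Qed.

Lemma fval0l v : fval 0 v = 0 :> R.
Proof. by rewrite /fval mulmx0 mxE. Qed.

Lemma fvalDr c v w : fval c (v + w) = fval c v + fval c w.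
Proof. by rewrite /fval mulmxDl mxE. Qed.

Lemma fvalZr a c v : fval c (a *: v) = a * fval c v.
Proof. by rewrite /fval -scalemxAl mxE. Qed.

Lemma fval_comb c a v b w :
  fval c (a *: v + b *: w) = a * fval c v + b * fval c w.
Proof. by rewrite fvalDr !fvalZr. Qed.

Lemma fval0r c : fval c 0 = 0.
Proof. by rewrite /fval mul0mx mxE. Qed.

Lemma fval_submx k (U : 'M[R]_(k, d)) c v :
  U *m c = 0 -> (v <= U)%MS -> fval c v = 0.
Proof. by move=> Uc /submxP[D ->]; rewrite /fval -mulmxA Uc mulmx0 mxE. Qed.

Lemma separating_functional k (U : 'M[R]_(k, d)) v :
  ~~ (v <= U)%MS -> exists2 c, U *m c = 0 & fval c v != 0.
Proof.
rewrite submxE => /rV0Pn[j vj].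
exists (col j (cokermx U)); first by rewrite colE mulmxA mulmx_coker mul0mx.
by rewrite /fval colE mulmxA -colE mxE.
Qed.

Variable n : nat.
Implicit Type X : 'I_n -> 'rV[R]_d.

(** For [eps] small enough, [eps *: g] cannot reverse a nonzero value of [f], so it decides only
    where [f] vanishes. *)
Lemma perturbation X f g : exists2 eps : R, 0 < eps & forall i,
  sgz (fval (f + eps *: g) (X i)) =
  if fval f (X i) == 0 then sgz (fval g (X i)) else sgz (fval f (X i)).
Proof.
(* Division by zero gives 0, so vectors killed by [f] add nothing to the sum that determines
   [eps]. *)
pose q i := `|fval g (X i)| / `|fval f (X i)|.
have q0 i : 0 <= q i by rewrite divr_ge0.
have s0 : 0 < 1 + \sum_i q i by rewrite ltr_wpDr ?sumr_ge0.
exists (1 + \sum_i q i)^-1 => [|i]; first by rewrite invr_gt0.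
rewrite fvalDl fvalZl; case: eqP => [-> | /eqP fi0].
  by rewrite add0r sgzM gtr0_sgz ?invr_gt0 ?mul1r.
set e := _^-1; have e0 : 0 < e by rewrite invr_gt0.
have lt_gf : `|e * fval g (X i)| < `|fval f (X i)|.
  rewrite normrM gtr0_norm // mulrC ltr_pdivrMr // mulrC -ltr_pdivrMr ?normr_gt0 //.
  rewrite -/(q i) (bigD1 i) //= addrCA ltrDl ltr_wpDr ?sumr_ge0 //.
have [fpos|fneg|f0] := ltgtP 0 (fval f (X i)).
- rewrite !gtr0_sgz //; move: lt_gf; rewrite (gtr0_norm fpos) ltr_norml => /andP[]; lra.
- rewrite !ltr0_sgz //; move: lt_gf; rewrite (ltr0_norm fneg) ltr_norml => /andP[]; lra.
- by rewrite -f0 eqxx in fi0.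
Qed.

(** Built one vector at a time: a small multiple of a functional separating the next vector from [U]
    keeps the values already made nonzero. *)
Lemma generic_functional k (U : 'M[R]_(k, d)) X :
  exists2 c, U *m c = 0 & forall i, (fval c (X i) == 0) = (X i <= U)%MS.
Proof.
suff [c Uc gen] : exists2 c, U *m c = 0 &
    forall i, i \in enum 'I_n -> ~~ (X i <= U)%MS -> fval c (X i) != 0.
  exists c => // i; apply/idP/idP => [|XU]; last by rewrite (fval_submx Uc XU).
  by apply: contraTT; apply: gen; rewrite mem_enum.
elim: (enum _) => [|j s [c Uc gen]]; first by exists 0; rewrite ?mulmx0.
have [XU|XU] := boolP (X j <= U)%MS.
  by exists c => // i; rewrite inE => /predU1P[->|/gen//]; rewrite XU.
have [g Ug gj] := separating_functional XU.
have [eps eps0 sg] := perturbation X c g.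
exists (c + eps *: g) => [|i]; first by rewrite mulmxDr -scalemxAr Uc Ug scaler0 addr0.
rewrite inE -sgz_eq0 sg => /predU1P[-> _|/gen XiU /XiU/negPf ci].
  by case: ifP => [_|/negbT]; rewrite sgz_eq0.
by rewrite ci sgz_eq0 ci.
Qed.

Definition balance X c : int := \sum_i sgz (fval c (X i)).

(** Discarded vectors become 0, which keeps the index type; zero vectors affect neither balance nor
    rank. *)
Definition restr X (P : pred 'I_n) i : 'rV[R]_d := if P i then X i else 0.

Definition cfgmx X : 'M[R]_(n, d) := \matrix_i X i.

Lemma row_cfgmx X i : row i (cfgmx X) = X i.
Proof. exact: rowK. Qed.

Lemma mem_cfgmx X i : (X i <= cfgmx X)%MS.
Proof. by rewrite -row_cfgmx row_sub. Qed.

Lemma zero_set_mul X f :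
  cfgmx (restr X (fun i => fval f (X i) == 0)) *m f = 0.
Proof.
apply/row_matrixP => i; rewrite row_mul row_cfgmx row0; apply/rowP => j.
by rewrite ord1 [RHS]mxE -/(fval f _) /restr; case: eqP => // _; exact: fval0r.
Qed.

Lemma balanceN X c : balance X (- c) = - balance X c.
Proof.
by rewrite /balance -sumrN; apply: eq_bigr => i _; rewrite fvalNl sgzN.
Qed.

(** Vectors off the zero set of [f] keep their sign; those on it get the sign of [g]. *)
Lemma balance_perturbation X f g : exists h,
  [/\ balance X h = balance X f + balance (restr X (fun i => fval f (X i) == 0)) g &
     forall i, sgz (fval h (X i)) =
       if fval f (X i) == 0 then sgz (fval g (X i)) else sgz (fval f (X i))].
Proof.
have [eps _ sg] := perturbation X f g; exists (f + eps *: g); split=> //.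
rewrite /balance -big_split; apply: eq_bigr => i _ /=; rewrite sg /restr.
by case: eqP => [->|_]; rewrite ?fval0r sgz0 ?add0r ?addr0.
Qed.

End Functionals.

(** Used to find a projective point of nonzero weight. *)
Lemma sum_fiber_neq0 (I : finType) (T : eqType) (V : zmodType)
    (phi : I -> T) (F : I -> V) :
  \sum_i F i != 0 -> exists u, \sum_(i | phi i == phi u) F i != 0.
Proof.
move=> F0; apply/existsP; apply: contraNT F0 => /existsPn all0; apply/eqP.
have -> : \sum_i F i = \sum_(t <- undup (codom phi)) \sum_(i | phi i == t) F i.
  rewrite (exchange_big_dep xpredT) //=; apply: eq_bigr => i _.
  under eq_bigl => t do rewrite eq_sym.
  rewrite -big_filter filter_pred1_uniq ?big_seq1 ?undup_uniq //.
  by rewrite mem_undup codom_f.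
rewrite big_seq big1 // => t; rewrite mem_undup => /codomP[u ->].
by apply/eqP; rewrite -[_ == _]negbK.
Qed.

(** * The projective picture: points, segments and minimal triangles *)

Section Triangle.
Variables (R : realType) (d n : nat) (X : 'I_n -> 'rV[R]_d) (e : 'cV[R]_d).
Hypothesis e_generic : forall i, (fval e (X i) == 0) = (X i == 0).

(** The line of a nonzero [X i] meets the affine chart [e = 1] in this point; parallel vectors share
    it. *)
Definition proj_point i := (fval e (X i))^-1 *: X i.
Definition proj_weight u : int :=
  \sum_(i | proj_point i == proj_point u) sgz (fval e (X i)).

Local Notation y := proj_point.
Local Notation A := proj_weight.

Lemma fval_proj_point c i : fval c (y i) = (fval e (X i))^-1 * fval c (X i).
Proof. exact: fvalZr. Qed.

Lemma fval_proj_point1 i : X i != 0 -> fval e (y i) = 1.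
Proof. by rewrite -e_generic fval_proj_point => /mulVf. Qed.

Lemma proj_pointK i : fval e (X i) *: y i = X i.
Proof.
have [Xi|Xi] := eqVneq (X i) 0; first by rewrite /y Xi !scaler0.
by rewrite scalerA mulfV ?e_generic // scale1r.
Qed.

Lemma fval_proj_pointK c i : fval c (X i) = fval e (X i) * fval c (y i).
Proof. by rewrite -[in LHS]proj_pointK fvalZr. Qed.

(** The negation of the conclusion of [unbalanced_wall], assumed to reach a contradiction. *)
Hypothesis balance_wall : forall f i,
  X i != 0 -> fval f (X i) = 0 -> balance X f = 0.

(** Both [f] and its perturbation by [g] vanish at [X i], so both are balanced, and the difference
    is the balance wanted. *)
Lemma balance_wall_restr f g i : X i != 0 -> fval f (X i) = 0 -> fval g (X i) = 0 ->
  balance (restr X (fun j => fval f (X j) == 0)) g = 0.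
Proof.
move=> Xi fi gi; have [h [Bh sh]] := balance_perturbation X f g.
have hi : fval h (X i) = 0.
  by apply/eqP; rewrite -sgz_eq0 sh fi eqxx gi sgz0.
by move: Bh; rewrite (balance_wall Xi fi) (balance_wall Xi hi) add0r.
Qed.

(** The barycentric coordinates [g1] and [g2] of the line through the two points each vanish at one
    end, so both are balanced on it. In the sum of these balances a vector on the line counts, up to
    the sign of [e], 1 at an end, 0 outside the segment and 2 inside. With no point inside, the sum
    is [A u + A v]. *)
Lemma proj_segment_point u v : X u != 0 -> X v != 0 -> y u != y v ->
  A u + A v != 0 ->
  exists i t, [/\ X i != 0, 0 < t < 1 & y i = (1 - t) *: y u + t *: y v].
Proof.
move=> Xu Xv yuv A0; apply: contrapT => no_between; move: A0.
apply/negP/negPn/eqP.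
have eu := fval_proj_point1 Xu; have ev := fval_proj_point1 Xv.
have [f Uf genf] := generic_functional (col_mx (y u) (y v)) X.
have yvu : ~~ (y u <= y v)%MS.
  apply: contraNN yuv => /sub_rVP[a ya]; move: eu.
  by rewrite ya fvalZr ev mulr1 => ->; rewrite scale1r.
have [g0 vg0 ug0] := separating_functional yvu.
pose g1 := (fval g0 (y u))^-1 *: g0; pose g2 := e - g1.
have g1u : fval g1 (y u) = 1 by rewrite fvalZl mulVf.
have g1v : fval g1 (y v) = 0 by rewrite fvalZl (fval_submx vg0 (submx_refl _)) mulr0.
have g2E x : fval g2 x = fval e x - fval g1 x by rewrite fvalDl fvalNl.
have fu : fval f (X u) = 0.
  rewrite fval_proj_pointK (fval_submx Uf) ?mulr0 //.
  by rewrite -addsmxE addsmxSl.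
have fv : fval f (X v) = 0.
  rewrite fval_proj_pointK (fval_submx Uf) ?mulr0 //.
  by rewrite -addsmxE addsmxSr.
have B1 : balance (restr X (fun j => fval f (X j) == 0)) g1 = 0.
  by apply: (balance_wall_restr Xv) => //; rewrite fval_proj_pointK g1v mulr0.
have B2 : balance (restr X (fun j => fval f (X j) == 0)) g2 = 0.
  apply: (balance_wall_restr Xu) => //.
  by rewrite fval_proj_pointK g2E g1u eu subrr mulr0.
have -> : A u + A v = balance (restr X (fun j => fval f (X j) == 0)) g1 +
                     balance (restr X (fun j => fval f (X j) == 0)) g2; last first.
  by rewrite B1 B2 addr0.
rewrite /A /balance -big_split /= !(big_mkcond (fun i => y i == _)) /= -big_split /=.
apply: eq_bigr => i _.
have [Xi|Xi] := eqVneq (X i) 0.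
  by rewrite /restr Xi !fval0r sgz0; do !case: ifP => _; rewrite ?fval0r ?sgz0.
have ei := fval_proj_point1 Xi.
rewrite /restr; have [|fi] := boolP (fval f (X i) == 0); last first.
  rewrite !fval0r sgz0.
  have fyu : fval f (y u) = 0 by rewrite fval_proj_point fu mulr0.
  have fyv : fval f (y v) = 0 by rewrite fval_proj_point fv mulr0.
  rewrite fval_proj_pointK mulf_eq0 e_generic (negPf Xi) /= in fi.
  case: eqP => [yi|_]; first by rewrite yi fyu eqxx in fi.
  by case: eqP => // yi; rewrite yi fyv eqxx in fi.
rewrite genf (fval_proj_pointK g1 i) (fval_proj_pointK g2 i) !sgzM g2E ei
  -addsmxE => Ui.
have : (y i <= y u + y v)%MS by rewrite scalemx_sub.
case/sub_addsmxP => -[a b] /= yiE.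
have {yiE} [a' [b' yiE]] : exists a' b', y i = a' *: y u + b' *: y v.
  exists (a 0 0), (b 0 0); rewrite yiE [a]mx11_scalar [b]mx11_scalar.
  by rewrite !mul_scalar_mx !mxE /= !mulr1n.
have ab : a' = 1 - b' by move: ei; rewrite yiE fval_comb eu ev; lra.
have g1i : fval g1 (y i) = a' by rewrite yiE fval_comb g1u g1v; lra.
have -> : 1 - fval g1 (y i) = b' by rewrite g1i ab; lra.
rewrite g1i.
have [yu|yu] := eqVneq (y i) (y u).
  have -> : a' = 1 by rewrite -g1i yu.
  have -> : b' = 0 by move: g1i; rewrite yu g1u; lra.
  by rewrite yu (negPf yuv) sgz0 sgz1 mulr1 mulr0.
have [yv|yv] := eqVneq (y i) (y v).
  have a0 : a' = 0 by rewrite -g1i yv.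
  have -> : b' = 1 by lra.
  by rewrite a0 sgz0 sgz1 mulr1 mulr0 addrC.
have a0 : a' != 0.
  apply: contraNneq yv => a0; rewrite yiE a0.
  have -> : b' = 1 by lra.
  by rewrite scale0r scale1r add0r.
have b0 : b' != 0.
  apply: contraNneq yu => b0; rewrite yiE ab b0.
  by rewrite subr0 scale0r scale1r addr0.
(* As [a' + b' = 1], nonzero coordinates are either both positive, giving a point inside the
   segment, or of opposite signs, which cancel. *)
rewrite -mulrDr.
have [ap|an|ap] := ltgtP 0 a'; last by rewrite -ap eqxx in a0.
  have [bp|bn|bp] := ltgtP 0 b'; last by rewrite -bp eqxx in b0.
    case: no_between; exists i, b'; split=> //; last by rewrite -ab.
    by apply/andP; split; lra.
  by rewrite (gtr0_sgz ap) (ltr0_sgz bn) subrr mulr0.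
have bp : 0 < b' by lra.
by rewrite (ltr0_sgz an) (gtr0_sgz bp) addNr mulr0.
Qed.

(** Twice the signed area in the coordinates [f], [g]. *)
Definition tri_area (f g : 'cV[R]_d) (u v w : 'I_n) :=
  (fval f (y v) - fval f (y u)) * (fval g (y w) - fval g (y u)) -
  (fval g (y v) - fval g (y u)) * (fval f (y w) - fval f (y u)).

(** In a triangle of least nonzero area, a point inside a side would cut off a smaller one that
    keeps the vertex [a] of nonzero weight. So any two of the three weights sum to 0, which forces
    [A a = 0]. *)
Lemma tri_area_eq0 f g u v w : X u != 0 -> X v != 0 -> X w != 0 ->
  A u != 0 -> tri_area f g u v w = 0.
Proof.
move=> Xu Xv Xw Au; apply/eqP; apply: contraPT isT => area0.
pose area (t : 'I_n * 'I_n * 'I_n) := tri_area f g t.1.1 t.1.2 t.2.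
pose good (t : 'I_n * 'I_n * 'I_n) :=
  [&& X t.1.1 != 0, X t.1.2 != 0, X t.2 != 0, A t.1.1 != 0 & area t != 0].
have good0 : good (u, v, w) by apply/and5P.
case: (arg_minP (fun t => `|area t|) good0) => -[[a b] c].
rewrite /good /= => /and5P[Xa Xb Xc Aa abc0] min_abc.
have smaller t t' : 0 < t < 1 -> area t' = t * area (a, b, c) ->
    X t'.1.1 != 0 -> X t'.1.2 != 0 -> X t'.2 != 0 -> A t'.1.1 != 0 -> False.
  move=> /andP[t0 t1] areaE X1 X2 X3 A1.
  have : good t' by rewrite /good X1 X2 X3 A1 areaE mulf_neq0 // gt_eqF.
  move=> /min_abc; rewrite areaE normrM (gtr0_norm t0).
  by apply/negP; rewrite -ltNge gtr_pMl ?normr_gt0.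
have distinct : [/\ y a != y b, y a != y c & y b != y c].
  by split; apply: contraNneq abc0; rewrite /area /tri_area /= => ->; apply/eqP; ring.
have [yab yac ybc] := distinct.
have Aab : A a + A b = 0.
  apply/eqP/negPn/negP => /(proj_segment_point Xa Xb yab)[i [t [Xi t01 yi]]].
  apply: (smaller t (a, i, c)) => //.
  by rewrite /area /tri_area /= yi !fval_comb; ring.
have Aac : A a + A c = 0.
  apply/eqP/negPn/negP => /(proj_segment_point Xa Xc yac)[i [t [Xi t01 yi]]].
  apply: (smaller t (a, b, i)) => //.
  by rewrite /area /tri_area /= yi !fval_comb; ring.
have Abc : A b + A c = 0.
  apply/eqP/negPn/negP => /(proj_segment_point Xb Xc ybc)[i [t [Xi t01 yi]]].
  apply: (smaller t (a, b, i)) => //.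
  by rewrite /area /tri_area /= yi !fval_comb; ring.
by move: Aa; rewrite (_ : A a = 0) ?eqxx //; lia.
Qed.

End Triangle.

(** * Rank at most twice the balance, without antipodal pairs *)

Section RankBound.
Variables (R : realType) (d n : nat).
Implicit Types (X : 'I_n -> 'rV[R]_d) (c e f g h : 'cV[R]_d).

Lemma generic_improvement X h : exists e,
  [/\ forall i, (fval e (X i) == 0) = (X i == 0), balance X h <= balance X e &
      forall i, fval h (X i) != 0 -> sgz (fval e (X i)) = sgz (fval h (X i))].
Proof.
have [g0 _ gen0] := generic_functional (0 : 'M[R]_d) X.
pose Z := restr X (fun i => fval h (X i) == 0).
have [g gen Bg] : exists2 g,
    forall i, (fval g (X i) == 0) = (X i == 0) & 0 <= balance Z g.
  have [g0p|g0n] := leP 0 (balance Z g0).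
    by exists g0 => // i; rewrite gen0 submx0.
  exists (- g0) => [i|]; first by rewrite fvalNl oppr_eq0 gen0 submx0.
  by rewrite balanceN oppr_ge0 ltW.
have [e [Be se]] := balance_perturbation X h g; exists e; split.
- move=> i; rewrite -sgz_eq0 se; case: ifP => [_|hi]; rewrite sgz_eq0 ?gen // hi.
  by apply/esym/negP => /eqP Xi; rewrite Xi fval0r eqxx in hi.
- by rewrite Be lerDl.
- by move=> i /negPf hi; rewrite se hi.
Qed.

(** Otherwise a vector whose point has nonzero weight, with two more independent of it, gives a
    triangle of nonzero area. *)
Lemma unbalanced_wall X h : (2 < \rank (cfgmx X))%N -> balance X h != 0 ->
  exists f i, [/\ X i != 0, fval f (X i) = 0 & balance X f != 0].
Proof.
move=> rkX Bh; apply: contrapT => noWall.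
have wall f i : X i != 0 -> fval f (X i) = 0 -> balance X f = 0.
  by move=> Xi fi; apply/eqP/negPn/negP => Bf; apply: noWall; exists f, i.
have [e gen Be] : exists2 e,
    forall i, (fval e (X i) == 0) = (X i == 0) & balance X e != 0.
  have [Bp|Bn|B0] := ltgtP 0 (balance X h); last by rewrite -B0 eqxx in Bh.
    have [e [gen Be _]] := generic_improvement X h.
    by exists e => //; rewrite gt_eqF // (lt_le_trans Bp).
  have [e [gen Be _]] := generic_improvement X (- h).
  by exists e => //; rewrite gt_eqF // (lt_le_trans _ Be) // balanceN oppr_gt0.
have [u Au] := sum_fiber_neq0 (proj_point X e) Be.
have Xu : X u != 0.
  apply: contraNneq Au => Xu; rewrite big1 // => i /eqP.
  rewrite -(proj_pointK gen) => ->.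
  by rewrite /proj_point Xu !scaler0 fval0r sgz0.
have outside k (U : 'M[R]_(k, d)) : (k < 3)%N -> exists v, ~~ (X v <= U)%MS.
  move=> k3; apply/existsP; rewrite -negb_forall; apply/negP => /forallP XU.
  have /mxrankS : (cfgmx X <= U)%MS by apply/row_subP => i; rewrite row_cfgmx.
  by move: (rank_leq_row U) => ? ?; lia.
have [v Xv] := outside _ (X u) isT.
have [w Xw] := outside _ (col_mx (X u) (X v)) isT.
have [f fu fv] := separating_functional Xv.
have [g guv gw] := separating_functional Xw.
have {}fu := fval_submx fu (submx_refl _).
have gu : fval g (X u) = 0 by rewrite (fval_submx guv) // -addsmxE addsmxSl.
have gv : fval g (X v) = 0 by rewrite (fval_submx guv) // -addsmxE addsmxSr.
have nz c x : fval c (X x) != 0 -> X x != 0.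
  by apply: contraNneq => ->; rewrite fval0r.
have Xv0 := nz _ _ fv; have Xw0 := nz _ _ gw.
(* In these coordinates the point of [u] is the origin and that of [v] lies on the first axis, so
   the area is a product of two nonzero values. *)
have := tri_area_eq0 gen wall f g Xu Xv0 Xw0 Au.
rewrite /tri_area !fval_proj_point fu gu gv !mulr0 !subr0 mul0r subr0.
by apply/eqP; rewrite !mulf_neq0 // invr_neq0 // gen.
Qed.

Lemma cfgmx_mulmxr X (C : 'M[R]_d) : cfgmx (fun i => X i *m C) = cfgmx X *m C.
Proof. by apply/row_matrixP => i; rewrite row_mul !row_cfgmx. Qed.

(* [C] below contracts the span of the zero set of [h], so that a wall of the
   contraction is a functional vanishing on strictly more vectors. *)
Lemma unbalanced_larger_flat X h :
  let Z f := cfgmx (restr X (fun i => fval f (X i) == 0)) in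
  (\rank (Z h) + 2 < \rank (cfgmx X))%N -> balance X h != 0 ->
  exists2 f, balance X f != 0 & (\rank (Z h) < \rank (Z f))%N.
Proof.
(* [P] projects onto the span of the zero set, so [C] kills exactly that span and fixes [h]. *)
move=> Z rkX Bh; pose P := pinvmx (Z h) *m Z h; pose C := 1%:M - P.
have ZC : Z h *m C = 0 by rewrite mulmxBr mulmx1 mulmxA mulmxKpV ?subrr ?submx_refl.
have Ch : C *m h = h by rewrite mulmxBl mul1mx -mulmxA zero_set_mul mulmx0 subr0.
have kerC m (x : 'M[R]_(m, d)) : x *m C = 0 -> (x <= Z h)%MS.
  by rewrite mulmxBr mulmx1 => /subr0_eq ->; rewrite mulmxA submxMl.
pose Y i := X i *m C.
have fvalY c i : fval c (Y i) = fval (C *m c) (X i) by rewrite /fval mulmxA.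
have BY c : balance Y c = balance X (C *m c).
  by apply: eq_bigr => i _; rewrite fvalY.
have rkY : (2 < \rank (cfgmx Y))%N.
  rewrite cfgmx_mulmxr -(ltn_add2r (\rank (Z h))) addnC (leq_trans rkX) //.
  rewrite -(mxrank_mul_ker _ C) leq_add2l mxrankS //.
  by apply: kerC; apply/sub_kermxP; apply: capmxSr.
have [|f [i [Yi fi Bf]]] := unbalanced_wall (h := h) rkY; first by rewrite BY Ch.
exists (C *m f); first by rewrite -BY.
have Zf : Z h *m (C *m f) = 0 by rewrite mulmxA ZC mul0mx.
have subZ : (Z h <= Z (C *m f))%MS.
  apply/row_subP => j; rewrite row_cfgmx /restr; case: ifP => hj; last exact: sub0mx.
  have Xj : (X j <= Z h)%MS.
    by have := mem_cfgmx (restr X (fun i => fval h (X i) == 0)) j; rewrite /restr hj.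
  have := mem_cfgmx (restr X (fun i => fval (C *m f) (X i) == 0)) j.
  by rewrite /restr (fval_submx Zf Xj) eqxx.
have Xi : (X i <= Z (C *m f))%MS.
  have := mem_cfgmx (restr X (fun i => fval (C *m f) (X i) == 0)) i.
  by rewrite /restr -fvalY fi eqxx.
have : (Z h < Z (C *m f))%MS.
  rewrite /ltmx subZ; apply: contraNN Yi => /(submx_trans Xi)/submxP[D XiE].
  by rewrite /Y XiE -mulmxA ZC mulmx0.
by rewrite ltmxErank => /andP[].
Qed.

(** The flat can be enlarged as long as its corank exceeds 2. *)
Lemma unbalanced_corank2 X h : balance X h != 0 ->
  exists2 f, balance X f != 0 &
    (\rank (cfgmx X) <= \rank (cfgmx (restr X (fun i => fval f (X i) == 0%R))) + 2)%N.
Proof.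
pose Z f := cfgmx (restr X (fun i => fval f (X i) == 0)); rewrite -/(Z _).
have [k] := ubnP (\rank (cfgmx X) - \rank (Z h))%N.
elim: k h => // k IHk h ltk Bh.
have [|lt2] := leqP (\rank (cfgmx X)) (\rank (Z h) + 2); first by exists h.
have [f Bf ltf] := unbalanced_larger_flat lt2 Bh.
apply: (IHk f) => //; move: ltk lt2 ltf; rewrite -/(Z h) -/(Z f).
by move: (\rank (cfgmx X)) (\rank (Z h)) (\rank (Z f)) => a b c; lia.
Qed.

(** Lengths may differ, since balance and codegree see only signs. *)
Definition antipodal (v w : 'rV[R]_d) : Prop := exists2 a, 0 < a & w = - a *: v.

(** On the line of [X u] all nonzero vectors point the same way, so [g1] has positive balance there.
    Perturbing [f] by [g1] and by [- g1] gives two different balances, not both 0. *)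
Lemma unbalanced_exists X u : X u != 0 ->
  (forall i, ~ antipodal (X u) (X i)) -> exists h, balance X h != 0.
Proof.
move=> Xu noanti; have [f Uf gen] := generic_functional (X u) X.
have /separating_functional[g _ gu] : ~~ (X u <= (0 : 'M[R]_d))%MS by rewrite submx0.
pose g1 := (fval g (X u))^-1 *: g; pose Z := restr X (fun i => fval f (X i) == 0).
have g1u : fval g1 (X u) = 1 by rewrite fvalZl mulVf.
have B0 : 0 < balance Z g1.
  rewrite /balance (bigD1 u) //= {1}/Z /restr gen submx_refl g1u sgz1.
  rewrite ltr_wpDr // sumr_ge0 // => i _; rewrite /Z /restr gen.
  case: ifP => [/sub_rVP[a Xi]|_]; last by rewrite fval0r sgz0.
  rewrite Xi fvalZr g1u mulr1 sgz_ge0 leNgt; apply/negP => a0.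
  by apply: (noanti i); exists (- a); rewrite ?oppr_gt0 ?opprK.
have [h1 [B1 _]] := balance_perturbation X f g1.
have [h2 [B2 _]] := balance_perturbation X f (- g1).
have [h10|] := eqVneq (balance X h1) 0; last by exists h1.
exists h2; rewrite B2 balanceN -/Z; move: B1; rewrite h10 -/Z => B1.
by apply/eqP; lia.
Qed.

(** Induction on the rank: the zero set of [h] has rank smaller by at most 2, and perturbing [h] by
    the functional found there adds [balance X h], at least 1. *)
Lemma rank_le_balance X :
  (forall i j, X i != 0 -> ~ antipodal (X i) (X j)) ->
  exists c, (\rank (cfgmx X))%:Z <= 2 * balance X c.
Proof.
have [k] := ubnP (\rank (cfgmx X)); elim: k X => // k IHk X ltk noanti.
have [rk0|rk_gt0] := posnP (\rank (cfgmx X)).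
  exists 0; rewrite rk0 /balance big1 ?mulr0 // => i _.
  by rewrite fval0l sgz0.
have [u Xu] : exists u, X u != 0.
  apply/existsP; apply: contraTT rk_gt0 => /existsPn X0.
  rewrite -leqNgt leqn0 mxrank_eq0; apply/eqP/row_matrixP => i.
  by rewrite row_cfgmx row0; apply/eqP/negPn/X0.
have [h0 Bh0] := unbalanced_exists Xu (fun i => noanti u i Xu).
have [h1 Bh1 rkh1] := unbalanced_corank2 Bh0.
pose Z f := restr X (fun i => fval f (X i) == 0).
have [h Bh rkh] : exists2 h, 0 < balance X h &
    (\rank (cfgmx X) <= \rank (cfgmx (Z h)) + 2)%N.
  have [Bp|Bn|B0] := ltgtP 0 (balance X h1); last by rewrite -B0 eqxx in Bh1.
    by exists h1.
  exists (- h1); first by rewrite balanceN oppr_gt0.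
  suff -> : cfgmx (Z (- h1)) = cfgmx (Z h1) by [].
  by apply/row_matrixP => i; rewrite !row_cfgmx /Z /restr fvalNl oppr_eq0.
have ZX : (cfgmx (Z h) <= cfgmx X)%MS.
  apply/row_subP => i; rewrite row_cfgmx /Z /restr.
  by case: ifP => _; rewrite ?sub0mx ?mem_cfgmx.
(* With equal ranks [h] would vanish on every vector and be balanced. *)
have rkZ : (\rank (cfgmx (Z h)) < \rank (cfgmx X))%N.
  rewrite ltn_neqAle mxrankS // andbT; apply: contraTneq Bh => rkE.
  have XZ : (cfgmx X <= cfgmx (Z h))%MS.
    by rewrite -(geq_leqif (mxrank_leqif_sup ZX)) rkE.
  rewrite /balance big1 ?ltxx // => i _.
  by rewrite (fval_submx (zero_set_mul X h)) ?sgz0 // (submx_trans (mem_cfgmx X i)).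
have [||c Bc] := IHk (Z h); first by apply: leq_trans rkZ _; rewrite -ltnS.
  move=> i j; rewrite /Z /restr; case: ifP => _; last by rewrite eqxx.
  case: ifP => _ Xi; first exact: noanti.
  case=> a a0 /esym/eqP; rewrite scaler_eq0 oppr_eq0 gt_eqF //= => /eqP Xi0.
  by rewrite Xi0 eqxx in Xi.
have [f [Bf _]] := balance_perturbation X h c; exists f.
by rewrite Bf -/(Z h); lia.
Qed.

End RankBound.

(** * Minima and sums over labelled families *)

Lemma bigminn_le (I : eqType) (s : seq I) (P : pred I) (F : I -> nat) m x :
  x \in s -> P x -> (\big[minn/m]_(i <- s | P i) F i <= F x)%N.
Proof.
elim: s => // y s IHs; rewrite inE big_cons => /predU1P[-> Py|xs Px].
  by rewrite Py geq_minl.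
by case: ifP => _; rewrite ?geq_min IHs ?orbT.
Qed.

Lemma card_setId_sum (T : finType) (S : {set T}) (P : pred T) :
  #|[set i in S | P i]| = (\sum_(i in S) P i)%N.
Proof.
by rewrite -sum1dep_card big_mkcondr; apply: eq_bigr => i _; case: (P i).
Qed.

Lemma big_block (T : Type) (idx : T) (op : Monoid.com_law idx) n k (p : 'I_n -> nat)
    (F : 'I_n -> T) : (forall i, p i <= k)%N ->
  \big[op/idx]_i F i =
  \big[op/idx]_(0 <= j < k.+1) \big[op/idx]_(i in [set i | p i == j]) F i.
Proof.
move=> pk; rewrite big_mkord
  (partition_big (fun i => inord (p i) : 'I_k.+1) xpredT) //=.
apply: eq_bigr => j _; apply: eq_bigl => i.
by rewrite inE -val_eqE /= inordK // ltnS.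
Qed.

Definition subfamily (R : realType) d n (V : 'I_n -> 'rV[R]_d) (S : {set 'I_n}) :=
  restr V (fun i => i \in S).

(** * Codegree, discrepancy and antipodal pairs *)

Section Decomposition.
Variables (R : realType) (dim n : nat) (V : 'I_n -> 'rV[R]_dim).
Implicit Types (c : 'cV[R]_dim) (S : {set 'I_n}).

Lemma nnonpos_le c S : (nnonpos V c S <= n)%N.
Proof. by rewrite -[leqRHS]card_ord max_card. Qed.

Lemma codeg_le c S : c != 0 -> (codeg V S <= nnonpos V c S)%N.
Proof.
move=> c0; have := nnonpos_le c S; rewrite -ltnS => lt.
apply: (@bigminn_le _ _ _ _ n (Ordinal lt)); first exact: mem_index_enum.
by apply/asboolP; exists c.
Qed.

Lemma codeg_attained c0 S : c0 != 0 -> exists2 c, c != 0 & codeg V S = nnonpos V c S.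
Proof.
move=> nz_c0; have : codeg V S = n \/ exists2 c, c != 0 & codeg V S = nnonpos V c S.
  rewrite /codeg; elim/big_ind: _ => [|a b [->|[c c0' ->]] [->|[c' c0'' ->]]|k].
  - by left.
  - by left; rewrite minnn.
  - by right; exists c' => //; rewrite (minn_idPr (nnonpos_le _ _)).
  - by right; exists c => //; rewrite (minn_idPl (nnonpos_le _ _)).
  - by right; case: leqP => _; [exists c|exists c'].
  - by move=> /asboolP[c [c0' <-]]; right; exists c.
(* The value [n] may be just the default of the minimum; [c0] then attains it. *)
case=> // codegE; exists c0 => //; apply/eqP.
by rewrite eqn_leq codeg_le // codegE nnonpos_le.
Qed.

Lemma balance_npos c :
  balance V c = (npos V c setT)%:Z - (nneg V c setT)%:Z.
Proof.
rewrite /balance /npos /nneg !card_setId_sum !(big_morph Posz PoszD (erefl _)).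
rewrite -sumrB; apply: eq_big => [i|i _]; first by rewrite inE.
by rewrite /sgz; case: ltgtP.
Qed.

Lemma npos_nneg_generic c : (forall i, fval c (V i) != 0) ->
  (npos V c setT + nneg V c setT)%N = n.
Proof.
move=> gen; rewrite /npos /nneg !card_setId_sum -big_split /=.
rewrite (eq_bigr (fun=> 1%N)) ?sum1_card ?cardsT ?card_ord // => i _.
by case: ltgtP (gen i).
Qed.

Lemma balance_le_DD c : balance V c <= (DD V setT)%:Z.
Proof.
have lt : (`|balance V c|%N < n.+1)%N.
  have := subset_leq_card (subsetT [set i in setT | 0 < fval c (V i)]).
  have := subset_leq_card (subsetT [set i in setT | fval c (V i) < 0]).
  by rewrite -/(npos V c setT) -/(nneg V c setT) cardsT card_ord balance_npos; lia.
apply: (@le_trans _ _ `|balance V c|%N%:Z); first by lia.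
rewrite lez_nat /DD; apply: (@leq_bigmax_cond _ _ _ (Ordinal lt)).
by apply/asboolP; exists c; rewrite -balance_npos.
Qed.

Lemma DD_attained : (0 < DD V setT)%N -> exists c, balance V c = (DD V setT)%:Z.
Proof.
have : DD V setT = 0%N \/ exists c, `|balance V c|%N = DD V setT.
  rewrite /DD; elim/big_ind: _ => [|a b Ha Hb|k].
  - by left.
  - by case: leqP.
  - by move=> /asboolP[c cE]; right; exists c; rewrite balance_npos.
case=> [->//|[c cE] D0].
have [B0|B0] := leP 0 (balance V c); first by exists c; lia.
by exists (- c); rewrite balanceN; lia.
Qed.

(** The dual degree before the rank is subtracted. *)
Definition max_npos : nat :=
  \big[maxn/0%N]_(k < n.+1 | `[< exists c, c != 0 /\ npos V c setT = k >]) (k : nat).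

Lemma max_npos_attained :
  max_npos = 0%N \/ exists2 c, c != 0 & npos V c setT = max_npos.
Proof.
rewrite /max_npos; elim/big_ind: _ => [|a b Ha Hb|k].
- by left.
- by case: leqP.
- by move=> /asboolP[c [c0 cE]]; right; exists c.
Qed.

Lemma npos_le_max c : c != 0 -> (npos V c setT <= max_npos)%N.
Proof.
move=> c0; have lt : (npos V c setT < n.+1)%N.
  by rewrite ltnS -[leqRHS]card_ord max_card.
apply: (@leq_bigmax_cond _ _ _ (Ordinal lt)).
by apply/asboolP; exists c.
Qed.

Lemma unbalanced_neq0 c : balance V c != 0 -> c != 0.
Proof.
by apply: contraNneq => ->; rewrite /balance big1 // => i _; rewrite fval0l sgz0.
Qed.

Hypothesis V_neq0 : forall i, V i != 0.

Lemma generic_improvement_neq0 h : exists e,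
  [/\ forall i, fval e (V i) != 0, balance V h <= balance V e &
      forall i, fval h (V i) != 0 -> sgz (fval e (V i)) = sgz (fval h (V i))].
Proof.
have [e [gen Be se]] := generic_improvement V h; exists e; split=> // i.
by rewrite gen V_neq0.
Qed.

Lemma balance_generic c : (forall i, fval c (V i) != 0) ->
  balance V c = 2 * (npos V c setT)%:Z - n%:Z.
Proof. by move=> /npos_nneg_generic; rewrite balance_npos; lia. Qed.

(** Both maxima are reached at functionals vanishing on no vector, where the balance is twice the
    positive count minus [n]. *)
Lemma DD_max_npos : (0 < DD V setT)%N -> (DD V setT)%:Z = 2 * max_npos%:Z - n%:Z.
Proof.
move=> D0; apply/eqP; rewrite eq_le; apply/andP; split.
  have [c Bc] := DD_attained D0.
  have [e [gen Be _]] := generic_improvement_neq0 c.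
  have /npos_le_max : e != 0 by apply: unbalanced_neq0; apply/eqP; lia.
  by have := balance_generic gen; lia.
have [->|[c c0 <-]] := max_npos_attained; first by lia.
have [e [gen _ se]] := generic_improvement_neq0 c.
have := balance_le_DD e; rewrite (balance_generic gen); apply: le_trans.
suff : (npos V c setT <= npos V e setT)%N by lia.
apply/subset_leq_card/subsetP => i; rewrite !inE /= => ci.
by rewrite -sgz_gt0 se ?sgz_gt0 // gt_eqF.
Qed.

Definition antipodal_pair S : Prop :=
  exists a b, [/\ a != b, S = [set a; b] & antipodal (V a) (V b)].

(** Stated for any commutative monoid, to serve both the integer sum of signs and the count of
    nonpositive values. *)
Lemma antipodal_pair_sum (T : Type) (idx : T) (op : Monoid.com_law idx)
    (F : R -> T) S c : antipodal_pair S -> exists x a, [/\ 0 < a,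
  \big[op/idx]_(i in S) F (fval c (V i)) = op (F x) (F (- a * x)) &
  exists i, x = fval c (V i)].
Proof.
move=> [i [j [ij -> [a a0 Vj]]]]; exists (fval c (V i)), a.
split=> //; last by exists i.
by rewrite big_setU1 ?inE //= big_set1 Vj fvalZr.
Qed.

Lemma antipodal_pair_balance S c : antipodal_pair S ->
  \sum_(i in S) sgz (fval c (V i)) = 0.
Proof.
move=> pS; have [x [a [a0 -> _]]] := antipodal_pair_sum +%R (@sgz R) c pS.
by rewrite /= mulNr sgzN sgzM (gtr0_sgz a0) mul1r subrr.
Qed.

Lemma antipodal_pair_nnonpos S c : antipodal_pair S -> (0 < nnonpos V c S)%N.
Proof.
move=> pS; rewrite /nnonpos card_setId_sum.
have [x [a [a0 -> _]]] :=
  antipodal_pair_sum addn (fun x : R => (x <= 0)%R : nat) c pS.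
rewrite /= mulNr oppr_le0; have [//|x0] := leP x 0.
by rewrite mulr_ge0 ?ltW.
Qed.

Lemma antipodal_pair_nnonpos1 S c : (forall i, fval c (V i) != 0) ->
  antipodal_pair S -> nnonpos V c S = 1%N.
Proof.
move=> gen pS; rewrite /nnonpos card_setId_sum.
have [x [a [a0 -> [i xi]]]] :=
  antipodal_pair_sum addn (fun x : R => (x <= 0)%R : nat) c pS.
rewrite /= mulNr oppr_le0 pmulr_rge0 //.
by have := gen i; rewrite -xi; case: ltgtP.
Qed.

(** Pairs are removed greedily, each receiving a new positive label; label 0 marks what stays
    unpaired. *)
Lemma antipodal_pairing S : exists k (p : 'I_n -> nat), [/\ forall i, (p i <= k)%N,
  forall i, i \notin S -> p i = 0%N,
  forall j, (0 < j <= k)%N -> antipodal_pair [set i | p i == j] &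
  forall a b, a \in S -> b \in S -> p a = 0%N -> p b = 0%N -> ~ antipodal (V a) (V b)].
Proof.
have [m] := ubnP #|S|; elim: m S => // m IHm S ltm.
have [[a [b [aS bS ab]]]|none] :=
  pselect (exists a b, [/\ a \in S, b \in S & antipodal (V a) (V b)]); last first.
  exists 0%N, (fun=> 0%N); split=> //; first by case.
  by move=> a b aS bS _ _ ab; apply: none; exists a, b.
have neq_ab : a != b.
  apply: contraPneq ab => <- [t t0 /eqP]; rewrite -subr_eq0 -scaleNr opprK.
  rewrite -[X in X + _]scale1r -scalerDl scaler_eq0 (negPf (V_neq0 a)) orbF.
  by apply/negP; rewrite gt_eqF // addr_gt0.
have [|k [p [pk pS pair noanti]]] := IHm (S :\ a :\ b).
  rewrite -ltnS (leq_trans _ ltm) // ltnS.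
  by rewrite (cardsD1 a S) aS (cardsD1 b (S :\ a)) !inE eq_sym neq_ab bS add1n leqnSn.
(* Lying outside the smaller set, [a] and [b] carry label 0, so relabelling them breaks no earlier
   pair. *)
have pa : p a = 0%N by apply: pS; rewrite !inE eqxx andbF.
have pb : p b = 0%N by apply: pS; rewrite !inE eqxx.
exists k.+1, (fun i => if i \in [set a; b] then k.+1 else p i); split.
- by move=> i; case: ifP => // _; apply: leqW.
- move=> i iS; case: ifP => [|_]; last by apply: pS; rewrite !inE (negPf iS) !andbF.
  by rewrite !inE => /orP[]/eqP iE; rewrite iE ?aS ?bS in iS.
- move=> j /andP[j0]; rewrite leq_eqVlt => /predU1P[->|jk].
    exists a, b; split=> //; apply/setP => i; rewrite !inE.
    by case: ifP => _; rewrite ?eqxx // ltn_eqF // ltnS.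
  have -> : [set i | (if i \in [set a; b] then k.+1 else p i) == j] =
            [set i | p i == j].
    apply/setP => i; rewrite !inE; case: ifP => // /orP[]/eqP->;
      rewrite ?pa ?pb gtn_eqF // ?(ltn_eqF j0) //.
  by apply: pair; rewrite j0.
- move=> x y xS yS; case: ifP => //; rewrite !inE => /norP[xa xb].
  case: ifP => // /norP[ya yb].
  by apply: noanti; rewrite !inE ?xa ?xb ?ya ?yb.
Qed.

Lemma rank_subfamily S :
  (\rank (cfgmx (subfamily V S)) <= #|S|)%N.
Proof.
have sub : (cfgmx (subfamily V S) <= \sum_(i in S) <<V i>>)%MS.
  apply/row_subP => i; rewrite row_cfgmx /subfamily /restr.
  case: ifP => iS; last exact: sub0mx.
  by rewrite (sumsmx_sup i) // genmxE.
apply: leq_trans (mxrankS sub) _; rewrite -sum1_card.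
elim/big_rec2: _ => [|i m B _ leB]; first by rewrite mxrank0.
apply: leq_trans (mxrank_adds_leqif _ _) _.
by rewrite leq_add // mxrank_gen rank_leq_row.
Qed.

(** * Effect of removing the pairs on rank, balance and codegree *)

Section Pairing.
Variables (k : nat) (p : 'I_n -> nat).
Hypothesis p_le : forall i, (p i <= k)%N.
Hypothesis p_pair : forall j, (0 < j <= k)%N -> antipodal_pair [set i | p i == j].
Let T := [set i | p i == 0%N].

(** The pairs are put back one by one; the two vectors of a pair are parallel, so each adds at most
    1. *)
Lemma rank_pairing :
  (\rank (cfgmx V) <= \rank (cfgmx (subfamily V T)) + k)%N.
Proof.
pose W m := cfgmx (restr V (fun i => (p i <= m)%N)).
have W0 : W 0%N = cfgmx (subfamily V T).
  by apply/row_matrixP => i; rewrite !row_cfgmx /subfamily /restr inE leqn0.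
have Wk : W k = cfgmx V.
  by apply/row_matrixP => i; rewrite !row_cfgmx /subfamily /restr p_le.
rewrite -W0 -Wk; elim: {-2}k (leqnn k) => [|m IHm] mk; first by rewrite addn0.
have [|a [b [_ pE [t _ Vb]]]] := p_pair (j := m.+1); first by rewrite mk.
have sub : (W m.+1 <= W m + V a)%MS.
  apply/row_subP => i; rewrite row_cfgmx /restr; case: ifP => pi; last exact: sub0mx.
  have [pim|pim] := leqP (p i) m.
    rewrite (submx_trans _ (addsmxSl _ _)) //.
    by have := mem_cfgmx (restr V (fun i => (p i <= m)%N)) i; rewrite /restr pim.
  rewrite (submx_trans _ (addsmxSr _ _)) //.
  have : i \in [set i | p i == m.+1] by rewrite inE eqn_leq pi.
  by rewrite pE !inE => /orP[]/eqP->; rewrite ?Vb ?scalemx_sub.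
apply: leq_trans (mxrankS sub) _; apply: leq_trans (mxrank_adds_leqif _ _) _.
by rewrite addnS -[leqRHS]addn1 leq_add ?rank_leq_row // IHm // ltnW.
Qed.

Lemma balance_pairing c : balance V c = balance (subfamily V T) c.
Proof.
rewrite {1}/balance (big_block _ _ p_le) big_nat_recl //= [X in _ + X]big_nat.
rewrite [X in _ + X]big1 ?addr0 => [|j /andP[_ jk]]; last first.
  exact/antipodal_pair_balance/p_pair.
rewrite /balance big_mkcond; apply: eq_bigr => i _.
by rewrite /subfamily /restr; case: ifP; rewrite ?fval0r ?sgz0.
Qed.

Lemma nnonpos_pairing c : nnonpos V c setT =
  (nnonpos V c T + \sum_(0 <= j < k) nnonpos V c [set i | p i == j.+1])%N.
Proof.
rewrite /nnonpos card_setId_sum; under eq_bigl do rewrite inE.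
rewrite (big_block _ _ p_le) big_nat_recl //= card_setId_sum; congr (_ + _)%N.
by apply: eq_bigr => j _; rewrite card_setId_sum.
Qed.

Lemma codeg_pair j : (0 < j <= k)%N -> codeg V [set i | p i == j] = 1%N.
Proof.
move=> /p_pair pj; have [i _] := pj; have [e [gen _ _]] := generic_improvement_neq0 0.
have e0 : e != 0 by apply: contraNneq (gen i) => ->; rewrite fval0l.
apply/eqP; rewrite eqn_leq -{1}(antipodal_pair_nnonpos1 gen pj) codeg_le //=.
by have [c _ ->] := codeg_attained [set i | p i == j] e0; apply: antipodal_pair_nnonpos.
Qed.

(** Upper bound: a minimizer on [T] is made generic without raising its count there, and each pair
    then contributes exactly 1. Lower bound: every functional is nonpositive somewhere on each pair.
    The index [i] ensures that a generic functional is nonzero. *)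
Lemma codeg_pairing (i : 'I_n) : codeg V setT = (codeg V T + k)%N.
Proof.
have genn0 e : (forall i, fval e (V i) != 0) -> e != 0.
  by move=> gen; apply: contraNneq (gen i) => ->; rewrite fval0l.
have [e1 [/genn0 e1n0 _ _]] := generic_improvement_neq0 0.
have sum_k : (\sum_(0 <= j < k) 1 = k)%N by rewrite sum_nat_const_nat subn0 muln1.
apply/eqP; rewrite eqn_leq; apply/andP; split.
  have [c c0 ->] := codeg_attained T e1n0.
  have [e [gen _ se]] := generic_improvement_neq0 c.
  apply: leq_trans (codeg_le _ (genn0 _ gen)) _; rewrite nnonpos_pairing leq_add //.
    apply/subset_leq_card/subsetP => j; rewrite !inE => /andP[-> ej] /=.
    rewrite leNgt; apply/negP => cj; move: ej.
    by rewrite -sgz_le0 se ?gt_eqF // gtr0_sgz.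
  rewrite -[leqRHS]sum_k [leqLHS]big_nat [leqRHS]big_nat leq_sum // => j /andP[_ jk].
  by rewrite (antipodal_pair_nnonpos1 gen) //; apply: p_pair.
have [c c0 ->] := codeg_attained setT e1n0.
rewrite nnonpos_pairing leq_add ?codeg_le // -[leqLHS]sum_k.
rewrite [leqLHS]big_nat [leqRHS]big_nat leq_sum // => j /andP[_ jk].
exact/antipodal_pair_nnonpos/p_pair.
Qed.

End Pairing.

(** Label 0 becomes the unconstrained block [ord0]. *)
Lemma codeg_decomposition_nat m (q : 'I_n -> nat) : (forall i, q i <= m)%N ->
  (forall j, 0 < j <= m -> 0 < codeg V [set i | q i == j])%N ->
  codeg V setT = (\sum_(0 <= j < m) codeg V [set i | q i == j.+1])%N ->
  exists p : 'I_n -> 'I_m.+1, codeg_decomposition V p.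
Proof.
move=> qm codeg_gt0 codegE; exists (fun i => inord (q i)).
have blockE j : block (fun i => inord (q i) : 'I_m.+1) j = [set i | q i == j].
  by apply/setP => i; rewrite !inE -val_eqE /= inordK // ltnS.
split=> [|j j0]; last by rewrite blockE codeg_gt0 // lt0n j0 -ltnS ltn_ord.
rewrite codegE big_mkord [RHS]big_mkcond [RHS]big_ord_recl /= add0r.
by apply: eq_bigr => j _; rewrite blockE.
Qed.

End Decomposition.

Theorem mainTheorem1 (R : realType) (dim n : nat) (V : 'I_n -> 'rV[R]_dim) :
  (forall i : 'I_n, V i != 0) ->
  (0 < DD V [set: 'I_n])%N ->
  let r : int := (crank V [set: 'I_n])%:Z in
  let delta : int := degs V [set: 'I_n] in
  let d : int := n%:Z - r - 1 in
  [/\ r + 1 - 2 * (DD V [set: 'I_n])%:Z = 2 * (d + 1 - 2 * delta) - r + 1,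
      2 * (d + 1 - 2 * delta) - r + 1 = 3 * d + 4 - 4 * delta - n%:Z
    & exists (m : nat) (p : 'I_n -> 'I_m.+1),
        codeg_decomposition V p /\ r + 1 - 2 * (DD V [set: 'I_n])%:Z <= m%:Z].
Proof.
move=> V0 D0 r delta d.
have deltaE : delta = (max_npos V)%:Z - r by [].
have DE := DD_max_npos V0 D0.
split; [by rewrite /d deltaE; lia | by rewrite /d deltaE; lia |].
have rE : r = (\rank (cfgmx V))%:Z.
  rewrite /r /crank; congr (\rank _)%:Z.
  by apply/row_matrixP => i; rewrite !rowK inE.
have [k [p [pk _ pair noanti]]] := antipodal_pairing V0 setT.
set T := [set i | p i == 0%N] in noanti *.
have rk := rank_pairing pk pair; rewrite -/T in rk.
have [c Bc] := DD_attained D0.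
(* An empty family would have discrepancy 0. *)
have [i0 _|none] := pickP (xpredT : pred 'I_n); last first.
  by move: Bc; rewrite /balance big_pred0 //; lia.
have codegV := codeg_pairing V0 pk pair i0; rewrite -/T in codegV.
(* If [codeg V T = 0], the rest [T] becomes the block of label 0 and the [k] pairs must suffice. *)
have [codegT|codegT] := posnP (codeg V T).
  exists k; have [||q qP] := @codeg_decomposition_nat _ _ _ V k p pk.
  - by move=> j jk; rewrite (codeg_pair V0 pair).
  - rewrite codegV codegT add0n big_nat (eq_bigr (fun=> 1%N)).
      by rewrite -big_nat sum_nat_const_nat subn0 muln1.
    by move=> j /andP[_ jk]; rewrite (codeg_pair V0 pair).
  exists q; split=> //.
  have c0 : c != 0 by apply: (@unbalanced_neq0 _ _ _ V); rewrite Bc; apply/eqP; lia.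
  have [e _ eE] := codeg_attained V T c0.
  (* A functional attaining codegree 0 is positive on all of [T]. Hence [#|T|], and so the rank of
     [T], is at most DD, giving [r <= DD + k]; as DD is at least 1, [k] is large enough. *)
  have BT : balance V e = #|T|%:Z.
    rewrite (balance_pairing pk pair) -/T -sum1_card (big_morph Posz PoszD (erefl _)).
    rewrite [RHS]big_mkcond; apply: eq_bigr => i _; rewrite /subfamily /restr.
    case: ifP => iT; last by rewrite fval0r sgz0.
    rewrite gtr0_sgz // ltNge; apply/negP => ei.
    have : i \in [set i in T | fval e (V i) <= 0] by rewrite inE iT.
    have /eqP : #|[set i in T | fval e (V i) <= 0]| = 0%N by rewrite -codegT eE.
    by rewrite cards_eq0 => /eqP->; rewrite inE.
  have := balance_le_DD V e; have := rank_subfamily V T.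
  rewrite BT rE; move: rk D0.
  by move: (\rank _) (\rank _) (#|_|) (DD _ _) => a b t D; lia.
(* Here [T] counts as one more block: it moves to label [k.+1], leaving block 0 empty. *)
pose q i := if p i == 0%N then k.+1 else p i.
have qE j : (j < k)%N -> [set i | q i == j.+1] = [set i | p i == j.+1].
  move=> jk; apply/setP => i; rewrite !inE /q; case: (p i =P 0%N) => [->|//].
  by rewrite eqSS gtn_eqF.
have qk : [set i | q i == k.+1] = T.
  apply/setP => i; rewrite !inE /q; have [_|_] := eqVneq (p i) 0%N.
    by rewrite eqxx.
  by rewrite ltn_eqF // ltnS.
exists k.+1; have [|||p' pP] := @codeg_decomposition_nat _ _ _ V k.+1 q.
- by move=> i; rewrite /q; case: ifP => // _; apply: leqW.
- case=> // j /andP[_]; rewrite ltnS leq_eqVlt => /predU1P[->|jk]; first by rewrite qk.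
  by rewrite qE // (codeg_pair V0 pair).
- rewrite codegV big_nat_recr //= qk addnC; congr (_ + _)%N.
  rewrite big_nat (eq_bigr (fun=> 1%N)).
    by rewrite -big_nat sum_nat_const_nat subn0 muln1.
  by move=> j /andP[_ jk]; rewrite qE // (codeg_pair V0 pair).
exists p'; split=> //.
(* Without antipodal pairs [T] has rank at most 2 DD, so [r <= 2 DD + k]. *)
have [i j|c' leB] := @rank_le_balance _ _ _ (subfamily V T).
  rewrite /subfamily /restr !inE; have [pi|_] := eqVneq (p i) 0%N; last by rewrite eqxx.
  have [pj _|_ Vi] := eqVneq (p j) 0%N; first by apply: noanti; rewrite ?inE.
  case=> a a0 /esym/eqP; rewrite scaler_eq0 oppr_eq0 gt_eqF //=.
  by rewrite (negPf Vi).
by have := balance_le_DD V c'; rewrite (balance_pairing pk pair) -/T rE; lia.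
Qed.
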